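(* Let $f:[0,1]^{n+1}\to\mathbb{R}^n$ be a polynomial in tensor-product Bernstein–Bézier form of degrees $(m_1,\ldots,m_{n+1})$ with $\kappa(f)<\infty$. Let $x^0\in[0,1]^{n+1}$ and $r>0$ be such that $X=\bar B(x^0,r)\subseteq[0,1]^{n+1}$. Let $\bar m=\max(m_1,\ldots,m_{n+1})$ and $$c_0=\frac{1}{64(n+1)^3\,\theta\,(1.5)^{\bar m}\,\bar m^2}.$$ If $r<\left(c_0/\kappa(f)\right)^2$, then either (1) $X$ passes the Kantorovich test and the associated explored region $X_E$ contains $X$, or (2) $X$ passes the exclusion test.
   Context: All norms are infinity norms (vector) and induced infinity norms (matrix); $\bar B(x,r)=\{y:\|y-x\|_\infty\le r\}$ and $B(x,r)$ its interior. $f(x)=\sum_{i_1=0}^{m_1}\cdots\sum_{i_{n+1}=0}^{m_{n+1}} b_{i_1,\ldots,i_{n+1}}Z_{i_1,m_1}(x_1)\cdots Z_{i_{n+1},m_{n+1}}(x_{n+1})$ with control points $b\in\mathbb{R}^n$ and $Z_{i,m}(t)=\binom{m}{i}(1-t)^{m-i}t^i$. $M=\|f\|=\max\|b_{i_1,\ldots,i_{n+1}}\|$. For an $n\times(n+1)$ matrix $A$ of rank $n$, $A^\dagger=A^T(AA^T)^{-1}$. $\kappa(f)=M\max_{x\in[0,1]^{n+1}}\min\{1/\|f(x)\|,\|f'(x)^\dagger\|\}$, with $1/\|f(x)\|=\infty$ if $f(x)=0$ and $\|f'(x)^\dagger\|=\infty$ if $\operatorname{rank}f'(x)<n$. $\theta=\prod_{k=1}^{n+1}\left(\sum_{i=0}^{m_k}\prod_{0\le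 i'\le m_k,\ i'\ne i}\frac{\max\{|m_k-i'|,|i'|\}}{|i-i'|}\right)$. Exclusion test: let $\hat f_X(q)=f(x^0-r\mathbf{1}+2rq)$ for $q\in[0,1]^{n+1}$, written in tensor-product Bernstein form of degrees $(m_1,\ldots,m_{n+1})$; $X$ passes if the convex hull of the control points of $\hat f_X$ does not contain the origin. Kantorovich test: let $D=[-0.5,1.5]^{n+1}$. For $i\in\{1,\ldots,n+1\}$ and $k\in\mathbb{R}$ let $h^{(ik)}(x)=(f(x),x_i-k)^T\in\mathbb{R}^{n+1}$, and $\eta=\|h^{(ik)\prime}(x^0)^{-1}h^{(ik)}(x^0)\|$. Let $G(x)=h^{(ik)\prime}(x^0)^{-1}h^{(ik)}(x)$ (its Jacobian does not depend on $k$), and $\hat G(y)=G(-0.5\cdot\mathbf{1}+2y)$ for $y\in[0,1]^{n+1}$. For each $i',j,k'$ write $\partial^2\hat G_{i'}/\partial y_j\partial y_{k'}$ in tensor-product Bernstein form (of the degrees obtained by differentiation), and let $\hat\omega=\frac{(n+1)^2}{2}$ times the maximum absolute value of all these control points over all $i',j,k'$. Set $\rho_\mp=(1\mp\sqrt{1-2\eta\hat\omega})/\hat\omega$ (denoted $\rho_\mp^{(k)}$ for $h^{(ik)}$). $X$ passes the Kantorovich test if there is $i$ such that for every $k\in[x_i^0-r,x_i^0+r]$: $h^{(ik)\prime}(x^0)$ is invertible, $\eta\hat\omega\le 1/4$, and $\bar B(x^0,\rho_-^{(k)})\subseteq D$. For such an $i$ the explored region is $X_E=\{x: x_i^0-r\le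 x_i\le x_i^0+r\}\cap D\cap\bigcap_{k\in[x_i^0-r,x_i^0+r]}\left(\bar B(x^0,\rho_-^{(k)})\cup B(x^0,\rho_+^{(k)})\right)$. *)

(* Defs.v *)
From HB Require Import structures.
From mathcomp Require Import all_boot all_order all_algebra.
From mathcomp Require Import all_classical all_reals all_analysis.
Set Implicit Arguments. Unset Strict Implicit. Unset Printing Implicit Defensive.
Import Order.TTheory GRing.Theory Num.Theory.
Local Open Scope ring_scope.
Local Open Scope classical_set_scope.

Section Defs.
Variable R : realType.

Definition Zb (i m : nat) (t : R) : R := 'C(m, i)%:R * (1 - t) ^+ (m - i) * t ^+ i.

Definition midx (N : nat) (d : 'I_N -> nat) := {dffun forall k : 'I_N, 'I_(d k).+1}.

Definition bbasis N (d : 'I_N -> nat) (l : midx d) (y : 'cV[R]_N) : R :=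
  \prod_(k < N) Zb (l k) (d k) (y k 0).

Definition bern N q (d : 'I_N -> nat) (c : midx d -> 'cV[R]_q) (y : 'cV[R]_N)
  : 'cV[R]_q := \sum_(l : midx d) bbasis l y *: c l.

Definition bern1 N (d : 'I_N -> nat) (c : midx d -> R) (y : 'cV[R]_N) : R :=
  \sum_(l : midx d) c l * bbasis l y.

Definition box N (a b : R) : set 'cV[R]_N := [set x | forall k, a <= x k 0 <= b].
Definition cube N : set 'cV[R]_N := @box N 0 1.

(* the control points of p in tensor-product Bernstein form of degrees d
   (unique; chosen by xget among representations valid on [0,1]^N) *)
Definition bern_coefs N q (d : 'I_N -> nat) (p : 'cV[R]_N -> 'cV[R]_q)
  : {ffun midx d -> 'cV[R]_q} :=
  xget [ffun=> 0] [set c | forall y, @cube N y -> p y = bern c y].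
Definition bern_coefs1 N (d : 'I_N -> nat) (p : 'cV[R]_N -> R)
  : {ffun midx d -> R} :=
  xget [ffun=> 0] [set c | forall y, @cube N y -> p y = bern1 c y].

Definition vnorm p (v : 'cV[R]_p) : R := \big[Num.max/0]_(j < p) `|v j 0|.
Definition mnorm p q (A : 'M[R]_(p, q)) : R :=
  \big[Num.max/0]_(i < p) \sum_(j < q) `|A i j|.

Definition cball N (x0 : 'cV[R]_N) (r : R) : set 'cV[R]_N :=
  [set x | vnorm (x - x0) <= r].
Definition oball N (x0 : 'cV[R]_N) (r : R) : set 'cV[R]_N :=
  [set x | vnorm (x - x0) < r].

Definition partial N (g : 'cV[R]_N -> R) (j : 'I_N) (x : 'cV[R]_N) : R :=
  derive1 (fun t : R => g (x + t *: delta_mx j 0)) 0.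

Definition jac p q (g : 'cV[R]_p -> 'cV[R]_q) (x : 'cV[R]_p) : 'M[R]_(q, p) :=
  \matrix_(a < q, b < p) partial (fun y => g y a 0) b x.

Definition pinv p q (A : 'M[R]_(p, q)) : 'M[R]_(q, p) := A^T *m invmx (A *m A^T).

Definition inv_norm p (y : 'cV[R]_p) : \bar R :=
  if vnorm y == 0 then +oo%E else (1 / vnorm y)%:E.
Definition pinv_norm n (A : 'M[R]_(n, n.+1)) : \bar R :=
  if (\rank A < n)%N then +oo%E else (mnorm (pinv A))%:E.

Definition ctrl_norm N q (d : 'I_N -> nat) (b : midx d -> 'cV[R]_q) : R :=
  \big[Num.max/0]_(l : midx d) vnorm (b l).

(* condition number kappa(f) (the max over the compact cube is written as sup) *)
Definition kappa n (m : 'I_n.+1 -> nat) (b : midx m -> 'cV[R]_n) : \bar R :=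
  ((ctrl_norm b)%:E *
   ereal_sup [set Order.min (inv_norm (bern b x)) (pinv_norm (jac (bern b) x))
             | x in @cube n.+1])%E.

Definition theta N (m : 'I_N -> nat) : R :=
  \prod_(k < N) \sum_(i < (m k).+1)
     \prod_(i' < (m k).+1 | i' != i)
        ((maxn (m k - i') i')%:R / `|i%:R - i'%:R|).

Definition mbar N (m : 'I_N -> nat) : nat := \max_(k < N) m k.

Definition c0 N (m : 'I_N -> nat) : R :=
  1 / (64 * (N%:R) ^+ 3 * theta m * (3 / 2) ^+ mbar m * (mbar m)%:R ^+ 2).

Definition fhat n (m : 'I_n.+1 -> nat) (b : midx m -> 'cV[R]_n)
  (x0 : 'cV[R]_n.+1) (r : R) (y : 'cV[R]_n.+1) : 'cV[R]_n :=
  bern b (x0 - r *: const_mx 1 + (2 * r) *: y).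

Definition zero_in_hull N q (d : 'I_N -> nat) (c : midx d -> 'cV[R]_q) : Prop :=
  exists lam : midx d -> R, (forall l, 0 <= lam l) /\
    \sum_l lam l = 1 /\ \sum_l lam l *: c l = 0.

Definition exclusion_test n (m : 'I_n.+1 -> nat) (b : midx m -> 'cV[R]_n)
  (x0 : 'cV[R]_n.+1) (r : R) : Prop :=
  ~ zero_in_hull (bern_coefs m (fhat b x0 r)).

Definition hfun n (m : 'I_n.+1 -> nat) (b : midx m -> 'cV[R]_n)
  (i : 'I_n.+1) (k : R) (x : 'cV[R]_n.+1) : 'cV[R]_n.+1 :=
  \col_(a < n.+1) match unlift ord_max a with
                  | Some a' => bern b x a' 0
                  | None => x i 0 - k
                  end.

Definition eta n (m : 'I_n.+1 -> nat) (b : midx m -> 'cV[R]_n)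
  (i : 'I_n.+1) (k : R) (x0 : 'cV[R]_n.+1) : R :=
  vnorm (invmx (jac (hfun b i k) x0) *m hfun b i k x0).

Definition Ghat n (m : 'I_n.+1 -> nat) (b : midx m -> 'cV[R]_n)
  (i : 'I_n.+1) (k : R) (x0 : 'cV[R]_n.+1) (y : 'cV[R]_n.+1) : 'cV[R]_n.+1 :=
  invmx (jac (hfun b i k) x0) *m hfun b i k (- (1 / 2) *: const_mx 1 + 2 *: y).

(* degree vector after differentiating in direction j *)
Definition decdeg N (d : 'I_N -> nat) (j : 'I_N) : 'I_N -> nat :=
  fun l => if l == j then (d l).-1 else d l.

Definition omega_hat n (m : 'I_n.+1 -> nat) (b : midx m -> 'cV[R]_n)
  (i : 'I_n.+1) (k : R) (x0 : 'cV[R]_n.+1) : R :=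
  (n.+1)%:R ^+ 2 / 2 *
  \big[Num.max/0]_(i' < n.+1) \big[Num.max/0]_(j < n.+1) \big[Num.max/0]_(k' < n.+1)
    \big[Num.max/0]_(l : midx (decdeg (decdeg m j) k'))
      `|bern_coefs1 (decdeg (decdeg m j) k')
          (partial (partial (fun y => Ghat b i k x0 y i' 0) j) k') l|.

(* rho_- and rho_+ ; for omega^ = 0 we use the limiting values eta and +oo *)
Definition rho_minus (eta om : R) : R :=
  if om == 0 then eta else (1 - Num.sqrt (1 - 2 * eta * om)) / om.
Definition rho_plus (eta om : R) : R := (1 + Num.sqrt (1 - 2 * eta * om)) / om.
Definition in_oball_plus N (x0 x : 'cV[R]_N) (eta om : R) : Prop :=
  om = 0 \/ oball x0 (rho_plus eta om) x.

Definition kantorovich_test_i n (m : 'I_n.+1 -> nat) (b : midx m -> 'cV[R]_n)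
  (x0 : 'cV[R]_n.+1) (r : R) (i : 'I_n.+1) : Prop :=
  forall k : R, x0 i 0 - r <= k <= x0 i 0 + r ->
    [/\ jac (hfun b i k) x0 \in unitmx,
        eta b i k x0 * omega_hat b i k x0 <= 1 / 4 &
        cball x0 (rho_minus (eta b i k x0) (omega_hat b i k x0))
          `<=` @box n.+1 (- (1 / 2)) (3 / 2)].

Definition explored_region n (m : 'I_n.+1 -> nat) (b : midx m -> 'cV[R]_n)
  (x0 : 'cV[R]_n.+1) (r : R) (i : 'I_n.+1) : set 'cV[R]_n.+1 :=
  [set x : 'cV[R]_n.+1 | x0 i 0 - r <= x i 0 <= x0 i 0 + r /\ @box n.+1 (- (1 / 2)) (3 / 2) x /\
     forall k : R, x0 i 0 - r <= k <= x0 i 0 + r ->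
       cball x0 (rho_minus (eta b i k x0) (omega_hat b i k x0)) x \/
       in_oball_plus x0 x (eta b i k x0) (omega_hat b i k x0)].

End Defs.

(* Main.v *)
Require Import Defs.
From HB Require Import structures.
From mathcomp Require Import all_boot all_order all_algebra.
From mathcomp Require Import all_classical all_reals all_analysis.
From mathcomp Require Import ring lra.
Import Order.TTheory GRing.Theory Num.Theory.
Local Open Scope ring_scope.
Local Open Scope classical_set_scope.

(** Every map used here (restriction to a sub-box, extension to [-1/2, 3/2]^N,
    partial differentiation) acts on control points through a tensor product of
    univariate matrices, so control points are estimated by products of l1 norms
    of columns. Writing the univariate basis as the coefficients of
    (1 - t + t X)^m, restriction to a box of radius r moves every control point
    by at most 2 N mbar r M from f(x0), and extension to [-1/2, 3/2]^N multiplies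
    norms by at most 2^(m_1 + ... + m_N), which is at most theta.

    If |f(x0)| > 2 N mbar r M, the exclusion test passes. Otherwise |f(x0)| is
    too small for 1/|f(x0)| to be at most kappa/M, so f'(x0)^+ has norm at most
    kappa/M; bordering f'(x0) with the coordinate in which its kernel vector is
    largest gives an inverse at most twice as large. Hence
    eta <= 6 N mbar kappa r and omega <= 4 N^2 mbar^2 theta kappa, and
    kappa >= 1/(2 N mbar) makes all Kantorovich conditions follow from the bound
    on r. *)

(** * Univariate Bernstein basis: reparametrization, differentiation, duality *)

Section UnivariateBernstein.
Context {R : realType}.
Implicit Types (i m l : nat) (t u y : R) (p q : {poly R}).

Definition lin t : {poly R} := (1 - t) *: 1 + t *: 'X.

Lemma exp_convex_comb m y p q :
  ((1 - y) *: p + y *: q) ^+ m =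
  \sum_(l < m.+1) Zb l m y *: (p ^+ (m - l) * q ^+ l).
Proof.
rewrite exprDn; apply: eq_bigr => l _.
rewrite !exprZn -scalerAl -scalerAr scalerA -scaler_nat scalerA.
by rewrite /Zb mulrA.
Qed.

Lemma Zb_coef_lin m i t : (i <= m)%N -> Zb i m t = (lin t ^+ m)`_i.
Proof.
move=> im; rewrite exp_convex_comb coef_sum.
under eq_bigr => l _ do rewrite expr1n mul1r coefZ coefXn.
have im' : (i < m.+1)%N by [].
rewrite (bigD1 (Ordinal im')) //= eqxx mulr1 big1 ?addr0 // => l.
by rewrite -val_eqE /= eq_sym => /negPf ->; rewrite mulr0.
Qed.

(** The blossom of the [i]-th basis polynomial, with [u] repeated [m - l] times and [v] repeated [l]
    times. *)
Definition reparam m u v i l : R := (lin u ^+ (m - l) * lin v ^+ l)`_i.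

Lemma Zb_reparam m i u v y : (i <= m)%N ->
  Zb i m ((1 - y) * u + y * v) =
  \sum_(l < m.+1) reparam m u v i l * Zb l m y.
Proof.
move=> im; rewrite Zb_coef_lin //.
have -> : lin ((1 - y) * u + y * v) = (1 - y) *: lin u + y *: lin v.
  apply/polyP => k; rewrite /lin !(coefD, coefZ, coef1, coefX); ring.
by rewrite exp_convex_comb coef_sum; apply: eq_bigr => l _; rewrite coefZ mulrC.
Qed.

(** With a fixed window of [K] coefficients no degree has to be tracked: multiplication by ['X] can
    only push coefficients out of the window. *)
Definition coef_l1 K p : R := \sum_(i < K) `|p`_i|.

Lemma coef_l1D K p q : coef_l1 K (p + q) <= coef_l1 K p + coef_l1 K q.
Proof.
rewrite /coef_l1 -big_split; apply: ler_sum => i _.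
by rewrite coefD ler_normD.
Qed.

Lemma coef_l1Z K a p : coef_l1 K (a *: p) = `|a| * coef_l1 K p.
Proof.
by rewrite /coef_l1 mulr_sumr; apply: eq_bigr => i _; rewrite coefZ normrM.
Qed.

Lemma coef_l1MX K p : coef_l1 K ('X * p) <= coef_l1 K p.
Proof.
rewrite /coef_l1; case: K => [|K]; first by rewrite !big_ord0.
rewrite big_ord_recl coefXM eqxx normr0 add0r big_ord_recr /=.
rewrite ler_wpDr // ?normr_ge0 //; apply: ler_sum => i _.
by rewrite coefXM.
Qed.

Lemma coef_l1_1 K : coef_l1 K 1 <= 1.
Proof.
rewrite /coef_l1; case: K => [|K]; first by rewrite big_ord0.
rewrite big_ord_recl coef1 normr1 big1 ?addr0 // => i _.
by rewrite coef1 normr0.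
Qed.

Lemma coef_l1_ge0 K p : 0 <= coef_l1 K p.
Proof. by apply: sumr_ge0 => i _; rewrite normr_ge0. Qed.

Lemma coef_l1_lcomb K a c p q :
  coef_l1 K (a *: p + c *: ('X * q)) <= `|a| * coef_l1 K p + `|c| * coef_l1 K q.
Proof.
apply: le_trans (coef_l1D _ _ _) _; rewrite !coef_l1Z lerD2l.
by rewrite ler_wpM2l // ?normr_ge0 // coef_l1MX.
Qed.

Lemma linM t p : lin t * p = (1 - t) *: p + t *: ('X * p).
Proof. by rewrite /lin mulrDl -!scalerAl mul1r. Qed.

Lemma coef_l1_linM K t B p : `|1 - t| + `|t| <= B ->
  coef_l1 K (lin t * p) <= B * coef_l1 K p.
Proof.
move=> tB; rewrite linM; apply: le_trans (coef_l1_lcomb _ _ _ _ _) _.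
by rewrite -mulrDl ler_wpM2r // coef_l1_ge0.
Qed.

Lemma coef_l1_linXM K t B k p : `|1 - t| + `|t| <= B ->
  coef_l1 K (lin t ^+ k * p) <= B ^+ k * coef_l1 K p.
Proof.
move=> tB; have B0 : 0 <= B by apply: le_trans tB; rewrite addr_ge0 ?normr_ge0.
elim: k => [|k IH]; first by rewrite !expr0 !mul1r.
rewrite !exprS -!mulrA; apply: le_trans (coef_l1_linM _ _ _ _ tB) _.
by rewrite ler_wpM2l.
Qed.

(** A column of the matrix is a product of [m] factors [lin], each multiplying the l1 norm by at
    most [B]. This serves with [B = 1] inside the unit interval and [B = 2] for the endpoints -1/2
    and 3/2. *)
Lemma coef_l1_reparam m l u v B : (l <= m)%N ->
  `|1 - u| + `|u| <= B -> `|1 - v| + `|v| <= B ->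
  \sum_(i < m.+1) `|reparam m u v i l| <= B ^+ m.
Proof.
move=> lm uB vB.
have B0 : 0 <= B by apply: le_trans uB; rewrite addr_ge0 ?normr_ge0.
rewrite -[m in B ^+ m](subnK lm) exprD.
apply: le_trans (coef_l1_linXM m.+1 u B (m - l) _ uB) _.
rewrite ler_wpM2l ?exprn_ge0 // -[lin v ^+ l]mulr1.
apply: le_trans (coef_l1_linXM m.+1 v B l _ vB) _.
by rewrite ler_piMr ?exprn_ge0 // coef_l1_1.
Qed.

Lemma unit_l1 t : 0 <= t <= 1 -> `|1 - t| + `|t| <= 1.
Proof.
by move=> /andP[t0 t1]; rewrite !ger0_norm ?subr_ge0 // subrK.
Qed.

(** Factors [lin t] are exchanged for [lin u] one at a time; each exchange costs at most [2 * r],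
    the other factors having norm at most 1. Starting from a given [p] allows a second run with
    another endpoint. *)
Lemma coef_l1_linX_sub K t u k p s (r : R) :
  0 <= t <= 1 -> 0 <= u <= 1 -> `|u - t| <= r ->
  coef_l1 K (p - lin t ^+ s) <= 2 * s%:R * r ->
  coef_l1 K (lin u ^+ k * p - lin t ^+ (k + s)) <= 2 * (k + s)%:R * r.
Proof.
move=> t01 u01 utr; elim: k => [|k IH] ps; first by rewrite expr0 mul1r.
have {IH} := IH ps; set P := lin u ^+ k * p => HP.
have -> : lin u ^+ k.+1 * p - lin t ^+ (k.+1 + s) =
  lin u * (P - lin t ^+ (k + s)) +
  ((t - u) *: lin t ^+ (k + s) + (u - t) *: ('X * lin t ^+ (k + s))).
  rewrite addSn !exprS -mulrA -/P mulrBr !linM.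
  move: (_ ^+ _) => Q; rewrite !scalerBl; ring.
apply: le_trans (coef_l1D _ _ _) _.
have H1 := coef_l1_linM K u 1 (P - lin t ^+ (k + s)) (unit_l1 _ u01).
have H2 := coef_l1_lcomb K (t - u) (u - t) (lin t ^+ (k + s)) (lin t ^+ (k + s)).
have H3 : coef_l1 K (lin t ^+ (k + s)) <= 1.
  rewrite -[lin t ^+ _]mulr1.
  apply: le_trans (coef_l1_linXM K t 1 _ _ (unit_l1 _ t01)) _.
  by rewrite expr1n mul1r coef_l1_1.
rewrite distrC in H2.
have H4 : `|u - t| * coef_l1 K (lin t ^+ (k + s)) <= r.
  rewrite -[leRHS]mulr1; apply: ler_pM => //; exact: coef_l1_ge0.
rewrite addSn -natr1 mul1r in H1 *; lra.
Qed.

Lemma reparam_near_Zb m l u v t (r : R) : (l <= m)%N ->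
  0 <= t <= 1 -> 0 <= u <= 1 -> 0 <= v <= 1 -> `|u - t| <= r -> `|v - t| <= r ->
  \sum_(i < m.+1) `|reparam m u v i l - Zb i m t| <= 2 * m%:R * r.
Proof.
move=> lm t01 u01 v01 ur vr.
have -> : \sum_(i < m.+1) `|reparam m u v i l - Zb i m t| =
   coef_l1 m.+1 (lin u ^+ (m - l) * (lin v ^+ l * 1) - lin t ^+ (m - l + l)).
  apply: eq_bigr => i _; rewrite Zb_coef_lin -1?ltnS // coefB.
  by rewrite mulr1 /reparam subnK.
rewrite -[m in 2 * m%:R](subnK lm).
(* Two runs: [m - l] factors for [u] on top of [l] factors for [v], the latter starting from the
   empty product. *)
apply: (@coef_l1_linX_sub _ t u (m - l) _ l) => //.
rewrite -{2 3}[l]addn0; apply: (@coef_l1_linX_sub _ t v l _ 0) => //.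
rewrite expr0 subrr mulr0 mul0r /coef_l1 big1 // => i _.
by rewrite coef0 normr0.
Qed.

Lemma Zb_ge0 i m t : 0 <= t <= 1 -> 0 <= Zb i m t.
Proof.
move=> /andP[t0 t1]; rewrite /Zb !mulr_ge0 ?exprn_ge0 ?subr_ge0 //.
Qed.

Lemma sum_Zb m t : \sum_(i < m.+1) Zb i m t = 1.
Proof.
have := exp_convex_comb m t 1 1.
rewrite -scalerDl subrK scale1r expr1n => /(congr1 (fun p => p`_0)).
rewrite coef1 coef_sum => H; rewrite [RHS]H; apply: eq_bigr => i _.
by rewrite !expr1n mulr1 coefZ coef1 mulr1.
Qed.

(** Column [l] encodes the forward difference giving the [l]-th control point [m (c_(l+1) - c_l)] of
    the derivative. *)
Definition dZb m i l : R := m%:R * ((i == l.+1)%:R - (i == l)%:R).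

Definition Zpoly i m : {poly R} := 'C(m, i)%:R *: ((1 - 'X) ^+ (m - i) * 'X^i).

Lemma horner_Zpoly i m t : (Zpoly i m).[t] = Zb i m t.
Proof. by rewrite /Zpoly !hornerE. Qed.

Lemma deriv_Zpoly i m t : (i <= m)%N ->
  (Zpoly i m)^`().[t] = \sum_(l < m.-1.+1) dZb m i l * Zb l m.-1 t.
Proof.
case: m => [|m].
  rewrite leqn0 => /eqP ->; rewrite big_ord1 /dZb mul0r mul0r /Zpoly !expr0 mulr1.
  by rewrite derivZ derivC scaler0 horner0.
move=> im; rewrite /=.
have pick_sum k : \sum_(l < m.+1) (k == l :> nat)%:R * Zb l m t = Zb k m t.
  have [km|km] := ltnP k m.+1.
    rewrite (bigD1 (Ordinal km)) //= eqxx mul1r big1 ?addr0 // => l.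
    by rewrite -val_eqE /= eq_sym => /negPf ->; rewrite mul0r.
  (* The index [m + 1] of the top basis function is absorbed by a vanishing binomial coefficient. *)
  rewrite /Zb bin_small // !mul0r big1 // => l _.
  by rewrite gtn_eqF ?mul0r // (leq_trans (ltn_ord l)).
have -> : \sum_(l < m.+1) dZb m.+1 i l * Zb l m t =
  m.+1%:R * ((if i is j.+1 then Zb j m t else 0) - Zb i m t).
  transitivity (m.+1%:R * (\sum_(l < m.+1) (i == l.+1)%:R * Zb l m t
      - \sum_(l < m.+1) (i == l :> nat)%:R * Zb l m t)).
    rewrite -sumrB mulr_sumr; apply: eq_bigr => l _.
    rewrite /dZb; ring.
  rewrite pick_sum; congr (_ * (_ - _)).
  case: (i) => [|j]; first by rewrite big1 // => l _; rewrite mul0r.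
  by under eq_bigr => l _ do rewrite eqSS; rewrite pick_sum.
rewrite /Zpoly derivZ derivM derivXn deriv_exp derivB derivX derivC sub0r.
have downR : (m.+1 - i)%:R * 'C(m.+1, i)%:R = m.+1%:R * 'C(m, i)%:R :> R.
  by rewrite -!natrM -mul_bin_down.
rewrite !(hornerZ, hornerD, hornerM, hornerN, hornerMn, horner_exp, hornerX, hornerC).
rewrite /Zb; case: i im downR => [|j] im downR.
  rewrite !bin0 !subn0 /= -[-1 * _ *+ _]mulr_natl mulr0n; ring.
have diagR : j.+1%:R * 'C(m.+1, j.+1)%:R = m.+1%:R * 'C(m, j)%:R :> R.
  by rewrite -!natrM -mul_bin_diag.
rewrite subSS in downR *.
rewrite -subnS -[-1 * _ *+ _]mulr_natl -[t ^+ j.+1.-1 *+ _]mulr_natl /=.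
move: (_ ^+ (m - j.+1)) (_ ^+ (m - j)) (t ^+ j.+1) (t ^+ j) => A B C D.
transitivity (j.+1%:R * 'C(m.+1, j.+1)%:R * B * D
   - (m - j)%:R * 'C(m.+1, j.+1)%:R * A * C); last by rewrite downR diagR; ring.
by ring.
Qed.

Lemma dZb_l1 m l : \sum_(i < m.+1) `|dZb m i l| <= 2 * m%:R.
Proof.
have pick_le k : \sum_(i < m.+1) (i == k :> nat)%:R <= 1 :> R.
  have [km|km] := ltnP k m.+1.
    rewrite (bigD1 (Ordinal km)) //= eqxx big1 ?addr0 // => i.
    by rewrite -val_eqE /= => /negPf ->.
  by rewrite big1 // => i _; rewrite ltn_eqF // (leq_trans (ltn_ord i)).
apply: (@le_trans _ _ (m%:R * (\sum_(i < m.+1) (i == l.+1 :> nat)%:R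
    + \sum_(i < m.+1) (i == l :> nat)%:R))); last first.
  rewrite mulrC ler_wpM2r //.
  by have := pick_le l; have := pick_le l.+1; lra.
rewrite -big_split mulr_sumr; apply: ler_sum => i _.
rewrite normrM ger0_norm // ler_wpM2l //.
by apply: le_trans (ler_normB _ _) _; rewrite !ger0_norm.
Qed.

(* At the node p / (p + 1) the basis is a rescaled monomial at p, so that the
   dual functionals come from an inverse Vandermonde matrix. *)
Lemma Zb_dual m : exists W : nat -> nat -> R, forall i l : nat,
  (i <= m)%N -> (l <= m)%N ->
  \sum_(p < m.+1) Zb i m (p%:R / p.+1%:R) * W p l = (i == l)%:R.
Proof.
pose a : 'rV[R]_m.+1 := \row_p p%:R; pose V := Vandermonde m.+1 a.
have Vunit : V \in unitmx.
  rewrite unitmxE det_Vandermonde unitfE.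
  apply/prodf_neq0 => i _; apply/prodf_neq0 => j ij.
  by rewrite !mxE subr_eq0 eqr_nat gtn_eqF.
exists (fun k l => k.+1%:R ^+ m * invmx V (inord k) (inord l) / 'C(m, l)%:R).
move=> i l im lm.
transitivity ('C(m, i)%:R * ((V *m invmx V) (inord i) (inord l)) / 'C(m, l)%:R).
  rewrite mxE mulr_sumr mulr_suml; apply: eq_bigr => p _.
  rewrite !mxE inord_val inordK // /Zb.
  have p1 : p.+1%:R != 0 :> R by rewrite pnatr_eq0.
  have -> : 1 - p%:R / p.+1%:R = p.+1%:R^-1 :> R.
    by apply: (mulIf p1); rewrite mulrBl divfK // mulVf // mul1r -natr1 addrC addKr.
  have -> : p.+1%:R ^+ m = p.+1%:R ^+ (m - i) * p.+1%:R ^+ i :> R.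
    by rewrite -exprD subnK.
  rewrite exprMn !exprVn.
  have A0 : p.+1%:R ^+ (m - i) != 0 :> R by rewrite expf_neq0.
  have B0 : p.+1%:R ^+ i != 0 :> R by rewrite expf_neq0.
  have C0 : 'C(m, l)%:R != 0 :> R by rewrite pnatr_eq0 -lt0n bin_gt0.
  by field; rewrite A0 B0 C0.
rewrite mulmxV // mxE -val_eqE /= !inordK //.
case: eqP => [->|_]; last by rewrite mulr0 mul0r.
by rewrite mulr1 divff // pnatr_eq0 -lt0n bin_gt0.
Qed.

End UnivariateBernstein.

(** The [i]-th summand dominates ['C(m, i)], the product of [(m - j) / (i - j)] over [j < i]: the
    factors with [j > i] are at least 1. *)
Lemma theta_factor_ge (R : realType) m :
  2 ^+ m <= \sum_(i < m.+1) \prod_(i' < m.+1 | i' != i)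
     ((maxn (m - i') i')%:R / `|i%:R - i'%:R|) :> R.
Proof.
have -> : 2 ^+ m = \sum_(i < m.+1) 'C(m, i)%:R :> R.
  have -> : 2 = 1 + 1 :> R by [].
  by rewrite exprDn; apply: eq_bigr => i _; rewrite !expr1n mulr1.
apply: ler_sum => i _.
have -> : 'C(m, i)%:R = \prod_(j < i) ((m - j)%:R / (i - j)%:R) :> R.
  have i0 : i`!%:R != 0 :> R by rewrite pnatr_eq0 -lt0n fact_gt0.
  apply: (mulIf i0); rewrite -natrM bin_ffact ffact_prod natr_prod.
  rewrite -ffactnn [in RHS]ffact_prod natr_prod -big_split /=.
  apply: eq_bigr => j _; rewrite divfK // pnatr_eq0 subn_eq0 -ltnNge.
  exact: ltn_ord.
rewrite (big_ord_widen m.+1 (fun j => (m - j)%:R / (i - j)%:R : R)); last first.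
  by rewrite ltnW.
rewrite big_mkcond [leRHS]big_mkcond /=; apply: ler_prod => j _.
have [-> | nij] := eqVneq j i; first by rewrite ltnn !lexx ler01.
case: ltnP => ij.
  rewrite divr_ge0 //= -natrB ?(ltnW ij) // ger0_norm //.
  by rewrite ler_wpM2r ?invr_ge0 // ler_nat leq_maxl.
have {}ij : (i < j)%N by rewrite ltn_neqAle ij andbT eq_sym.
rewrite ler01 /= distrC -natrB ?(ltnW ij) // ger0_norm //.
rewrite ler_pdivlMr ?ltr0n ?subn_gt0 // mul1r ler_nat.
by rewrite (leq_trans (leq_subr _ _)) // leq_maxr.
Qed.

(** * Tensor products of univariate matrices acting on control points *)

Section Tensor.
Context {R : realType} {N : nat}.
Implicit Types (d : 'I_N -> nat) (S : 'I_N -> nat -> nat -> R).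

Lemma theta_ge d : \prod_(k < N) 2 ^+ d k <= theta R d.
Proof.
apply: ler_prod => k _; rewrite exprn_ge0 //=; exact: theta_factor_ge.
Qed.

(** Distributivity with ranges depending on [k]; the general law is stated for tagged unions, hence
    the detour through [fprod]. *)
Lemma prod_sum_midx d (F : 'I_N -> nat -> R) :
  \prod_k \sum_(j < (d k).+1) F k j = \sum_(l : midx d) \prod_k F k (l k).
Proof.
pose T_ k : finType := 'I_(d k).+1.
pose P_ k : {ffun T_ k -> R} := [ffun j => F k (nat_of_ord j)].
transitivity (\prod_k \sum_(j in tagged_with T_ k) untag 0 (P_ k) j).
  by apply: eq_bigr => k _; rewrite -(big_tag (fun k j => P_ k j) k);
    apply: eq_bigr => j _; rewrite ffunE.
rewrite bigA_distr_big_dep -big_fprod.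
rewrite (reindex (@fprod_of_dffun _ T_)); last first.
  exact/onW_bij/fprod_of_dffun_bij.
by apply: eq_bigr => l _; apply: eq_bigr => k _; rewrite ffunE fprodE.
Qed.

Definition tcoef {d d'} S (c : midx d -> R) (l : midx d') : R :=
  \sum_(i : midx d) c i * \prod_k S k (i k) (l k).

(** Common source of the control points after substitution and after differentiation: univariate
    expansions multiply out to a tensor expansion. *)
Lemma bern1_tcoef d d' S (phi : 'I_N -> nat -> R) (c : midx d -> R)
  (y : 'cV[R]_N) :
  (forall k i, (i <= d k)%N ->
     phi k i = \sum_(l < (d' k).+1) S k i l * Zb l (d' k) (y k 0)) ->
  \sum_(i : midx d) c i * \prod_k phi k (i k) = bern1 (tcoef S c : midx d' -> R) y.
Proof.
move=> H.
under eq_bigr => i _.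
  rewrite (eq_bigr (fun k => \sum_(l < (d' k).+1) S k (i k) l * Zb l (d' k) (y k 0)));
    last by move=> k _; rewrite H // -ltnS.
  rewrite (prod_sum_midx d' (fun k l => S k (i k) l * Zb l (d' k) (y k 0))) mulr_sumr.
  over.
rewrite exchange_big; apply: eq_bigr => l _ /=.
rewrite /tcoef mulr_suml; apply: eq_bigr => i _.
by rewrite -mulrA /bbasis -big_split.
Qed.

Lemma sum_prod_norm d (F : 'I_N -> nat -> R) (B : 'I_N -> R) :
  (forall k, \sum_(i < (d k).+1) `|F k i| <= B k) ->
  \sum_(i : midx d) `|\prod_k F k (i k)| <= \prod_k B k.
Proof.
move=> H; rewrite (eq_bigr (fun i : midx d => \prod_k `|F k (i k)|)); last first.
  by move=> i _; rewrite normr_prod.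
rewrite -(prod_sum_midx d (fun k i => `|F k i|)).
by apply: ler_prod => k _; rewrite H andbT sumr_ge0.
Qed.

Lemma tcoef_le d d' S (c : midx d -> R) (l : midx d') (M : R) (B : 'I_N -> R) :
  (forall i, `|c i| <= M) ->
  (forall k, \sum_(i < (d k).+1) `|S k i (l k)| <= B k) ->
  `|tcoef S c l| <= M * \prod_k B k.
Proof.
move=> cM SB.
have M0 : 0 <= M by apply: le_trans (cM [ffun=> ord0]); exact: normr_ge0.
apply: le_trans (ler_norm_sum _ _ _) _.
apply: le_trans (_ : M * \sum_(i : midx d) `|\prod_k S k (i k) (l k)| <= _).
  by rewrite mulr_sumr; apply: ler_sum => i _; rewrite normrM ler_wpM2r.
by rewrite ler_wpM2l //; apply: (sum_prod_norm d (fun k i => S k i (l k))).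
Qed.

(** Telescoping: the hybrid [H j] uses [F] in the first [j] directions and [G] in the others.
    Consecutive hybrids differ by a product with [F - G] in direction [j] and factors of l1 norm at
    most 1 elsewhere. *)
Lemma sum_prod_sub d (F G : 'I_N -> nat -> R) (e : 'I_N -> R) :
  (forall k, \sum_(i < (d k).+1) `|F k i| <= 1) ->
  (forall k, \sum_(i < (d k).+1) `|G k i| <= 1) ->
  (forall k, \sum_(i < (d k).+1) `|F k i - G k i| <= e k) ->
  \sum_(i : midx d) `|\prod_k F k (i k) - \prod_k G k (i k)| <= \sum_k e k.
Proof.
move=> F1 G1 FGe.
pose H (j : nat) (k : 'I_N) a := if (k < j)%N then F k a else G k a.
pose E (j : 'I_N) (k : 'I_N) a :=
  if (k < j)%N then F k a else if k == j then F k a - G k a else G k a.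
have EH (i : midx d) (j : 'I_N) : \prod_k H j.+1 k (i k) - \prod_k H j k (i k) =
    \prod_k E j k (i k).
  rewrite !(bigD1 (P := xpredT) j) //= {1 3}/H /E !ltnn ltnSn eqxx mulrBl.
  congr (_ * _ - _ * _); apply: eq_bigr => k kj; rewrite /H ?(negPf kj) //.
  by rewrite ltnS leq_eqVlt val_eqE (negPf kj).
have FG (i : midx d) : \prod_k F k (i k) - \prod_k G k (i k) =
    \sum_(j < N) \prod_k E j k (i k).
  under [RHS]eq_bigr => j _ do rewrite -EH.
  rewrite -(big_mkord xpredT (fun j => \prod_k H j.+1 k (i k) - \prod_k H j k (i k))).
  rewrite telescope_sumr //; congr (_ - _); apply: eq_bigr => k _ //.
  by rewrite /H ltn_ord.
under eq_bigr => i _ do rewrite FG.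
apply: (@le_trans _ _ (\sum_(i : midx d) \sum_(j < N) `|\prod_k E j k (i k)|)).
  by apply: ler_sum => i _; exact: ler_norm_sum.
rewrite exchange_big; apply: ler_sum => j _ /=.
have -> : e j = \prod_k (if k == j then e j else 1).
  by rewrite -big_mkcond big_pred1_eq.
apply: (sum_prod_norm d (E j)) => k; rewrite /E.
by case: eqP => [->|_]; [rewrite ltnn; exact: FGe | case: ltnP].
Qed.

(** Tensor products of the dual functionals recover each control point from values at the nodes
    [p / (p + 1)], which lie in the cube. *)
Lemma bern1_uniq d (c c' : midx d -> R) :
  (forall y, @cube R N y -> bern1 c y = bern1 c' y) -> c =1 c'.
Proof.
have [W Wdual] := choice (fun k => @Zb_dual R (d k)).
pose node (p : midx d) : 'cV[R]_N := \col_k ((p k)%:R / (p k).+1%:R).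
have cube_node p : @cube R N (node p).
  move=> k; rewrite mxE divr_ge0 //= ler_pdivrMr ?ltr0n // mul1r ler_nat.
  exact: leqnSn.
have recover (a : midx d -> R) l :
    a l = \sum_(p : midx d) bern1 a (node p) * \prod_k W k (p k) (l k).
  rewrite /bern1; under eq_bigr => p _ do rewrite mulr_suml.
  rewrite exchange_big /=.
  have E i : \sum_(p : midx d) a i * bbasis i (node p) * \prod_k W k (p k) (l k)
      = a i * (i == l)%:R.
    under eq_bigr => p _.
      rewrite -mulrA /bbasis -big_split /=.
      under eq_bigr => k _ do rewrite mxE.
      over.
    rewrite -mulr_sumr; congr (_ * _).
    rewrite -(prod_sum_midx d
      (fun k p => Zb (i k) (d k) (p%:R / p.+1%:R) * W k p (l k))).
    under eq_bigr => k _ do rewrite Wdual -1?ltnS ?ltn_ord //.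
    case: (eqVneq i l) => [->|il]; first by rewrite big1 // => k _; rewrite eqxx.
    have [k kil] : exists k, i k != l k.
      apply/existsP; rewrite -negb_forall; apply: contraNN il => /forallP H.
      by apply/eqP/ffunP => k; apply/eqP.
    by rewrite (bigD1 k) //= val_eqE (negPf kil) mul0r.
  rewrite (eq_bigr _ (fun i _ => E i)) (bigD1 l) //= eqxx mulr1 big1 ?addr0 //.
  by move=> i /negPf ->; rewrite mulr0.
move=> H l; rewrite recover [RHS]recover.
by apply: eq_bigr => p _; rewrite H.
Qed.

Lemma bern_coord q d (c : midx d -> 'cV[R]_q) (y : 'cV[R]_N) a :
  bern c y a 0 = bern1 (fun l => c l a 0) y.
Proof.
by rewrite /bern summxE; apply: eq_bigr => l _; rewrite mxE mulrC.
Qed.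

(** The set given to [xget] contains [c], so the chosen family represents [g] and uniqueness
    identifies it with [c]. Explicit control points may thus replace the choice. *)
Lemma bern_coefs1P d (g : 'cV[R]_N -> R) (c : midx d -> R) :
  (forall y, @cube R N y -> g y = bern1 c y) -> bern_coefs1 d g =1 c.
Proof.
move=> H; have := @xgetPex _ [ffun=> 0]
  [set c' : {ffun midx d -> R} | forall y, @cube R N y -> g y = bern1 c' y].
rewrite -/(bern_coefs1 d g) => /(_ _)/wrap[|H'].
  exists [ffun l => c l] => y cy; rewrite H //.
  by apply: eq_bigr => l _; rewrite ffunE.
by apply: bern1_uniq => y cy; rewrite -H // -H'.
Qed.

Lemma bern_coefsP q d (g : 'cV[R]_N -> 'cV[R]_q) (c : midx d -> 'cV[R]_q) :
  (forall y, @cube R N y -> g y = bern c y) -> bern_coefs d g =1 c.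
Proof.
move=> H; have := @xgetPex _ [ffun=> 0]
  [set c' : {ffun midx d -> 'cV[R]_q} | forall y, @cube R N y -> g y = bern c' y].
rewrite -/(bern_coefs d g) => /(_ _)/wrap[|H'].
  exists [ffun l => c l] => y cy; rewrite H //.
  by apply: eq_bigr => l _; rewrite ffunE.
move=> l; apply/matrixP => a z; rewrite ord1.
apply: (bern1_uniq d (fun l => bern_coefs d g l a 0) (fun l => c l a 0)).
by move=> y cy; rewrite -!bern_coord -H // -H'.
Qed.

Lemma bern1_le d (c : midx d -> R) (M : R) (y : 'cV[R]_N) :
  (forall l, `|c l| <= M) -> @cube R N y -> `|bern1 c y| <= M.
Proof.
move=> cM cy.
have M0 : 0 <= M by apply: le_trans (cM [ffun=> ord0]); exact: normr_ge0.
have b0 l : 0 <= bbasis (l : midx d) y by apply: prodr_ge0 => k _; exact: Zb_ge0.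
apply: le_trans (ler_norm_sum _ _ _) _.
have <- : M * \sum_(l : midx d) bbasis l y = M.
  rewrite -(prod_sum_midx d (fun k i => Zb i (d k) (y k 0))).
  by rewrite big1 ?mulr1 // => k _; rewrite sum_Zb.
rewrite mulr_sumr; apply: ler_sum => l _.
by rewrite normrM (ger0_norm (b0 l)) ler_wpM2r.
Qed.

(** The corners [u] and [v] may lie outside the cube, so this covers both restriction and
    extension. *)
Definition box_coef {d} (u v : 'I_N -> R) : (midx d -> R) -> midx d -> R :=
  tcoef (fun k => reparam (d k) (u k) (v k)).

Lemma bern1_box d (u v : 'I_N -> R) (c : midx d -> R) (y : 'cV[R]_N) :
  bern1 c (\col_k ((1 - y k 0) * u k + y k 0 * v k)) = bern1 (box_coef u v c) y.
Proof.
rewrite /bern1.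
under eq_bigr => l _.
  rewrite /bbasis; under eq_bigr => k _ do rewrite mxE.
  over.
apply: (bern1_tcoef d d _
  (fun k i => Zb i (d k) ((1 - y k 0) * u k + y k 0 * v k))) => k i.
exact: Zb_reparam.
Qed.

Lemma box_coef_le d (u v : 'I_N -> R) (c : midx d -> R) (M B : R) l :
  (forall k, `|1 - u k| + `|u k| <= B) -> (forall k, `|1 - v k| + `|v k| <= B) ->
  (forall i, `|c i| <= M) -> `|box_coef u v c l| <= M * \prod_k B ^+ d k.
Proof.
move=> uB vB cM; apply: tcoef_le => // k.
by apply: coef_l1_reparam; rewrite // -ltnS.
Qed.

(** The value at [x] is also a tensor contraction of [c], and in each direction its vector of basis
    values is l1-close to every column of [reparam]. *)
Lemma box_coef_near d (u v : 'I_N -> R) (c : midx d -> R) (M r : R)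
  (x : 'cV[R]_N) l : @cube R N x ->
  (forall k, 0 <= u k <= 1) -> (forall k, 0 <= v k <= 1) ->
  (forall k, `|u k - x k 0| <= r) -> (forall k, `|v k - x k 0| <= r) ->
  (forall i, `|c i| <= M) ->
  `|box_coef u v c l - bern1 c x| <= M * \sum_k 2 * (d k)%:R * r.
Proof.
move=> cx u01 v01 ur vr cM.
have M0 : 0 <= M by apply: le_trans (cM [ffun=> ord0]); exact: normr_ge0.
rewrite /box_coef /tcoef /bern1 -sumrB.
apply: le_trans (ler_norm_sum _ _ _) _.
apply: (@le_trans _ _ (M * \sum_(i : midx d)
   `|\prod_k reparam (d k) (u k) (v k) (i k) (l k)
     - \prod_k Zb (i k) (d k) (x k 0)|)).
  rewrite mulr_sumr; apply: ler_sum => i _.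
  by rewrite -mulrBr normrM ler_wpM2r.
rewrite ler_wpM2l //.
apply: (sum_prod_sub d (fun k i => reparam (d k) (u k) (v k) i (l k))
  (fun k i => Zb i (d k) (x k 0))) => k.
- rewrite -(expr1n _ (d k)); apply: coef_l1_reparam; rewrite -1?ltnS //;
  exact: unit_l1.
- under eq_bigr => i _ do rewrite ger0_norm ?Zb_ge0 //.
  by rewrite sum_Zb.
- by apply: reparam_near_Zb; rewrite -1?ltnS.
Qed.

Definition dcoef_mx d j k i l : R :=
  if k == j :> 'I_N then dZb (d k) i l else (i == l)%:R.

Definition dcoef {d} j (c : midx d -> R) : midx (decdeg d j) -> R :=
  tcoef (dcoef_mx d j) c.

Lemma dcoef_le d j (c : midx d -> R) (M : R) l :
  (forall i, `|c i| <= M) -> `|dcoef j c l| <= M * (2 * (d j)%:R).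
Proof.
move=> cM.
have -> : 2 * (d j)%:R = \prod_k (if k == j then 2 * (d k)%:R else 1) :> R.
  by rewrite -big_mkcond big_pred1_eq.
apply: tcoef_le => // k; rewrite /dcoef_mx; case: eqP => [_|kj].
  exact: dZb_l1.
(* Away from [j] the degree is unchanged, so the identity column has a single entry 1. *)
have lk : (l k < (d k).+1)%N.
  by apply: leq_trans (ltn_ord (l k)) _; rewrite /decdeg; move/eqP/negPf: kj => ->.
rewrite (bigD1 (Ordinal lk)) //= eqxx normr1 big1 ?addr0 // => i.
by rewrite -val_eqE /= => /negPf ->; rewrite normr0.
Qed.

(** The affine term is kept apart because a coordinate function need not have a Bernstein form of
    degrees [d]: [d i] may be 0. *)
Lemma partial_bern1 d (c : midx d -> R) (al be : R) (i j : 'I_N) :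
  partial (fun y => bern1 c y + (al + be * y i 0)) j =
  (fun y => bern1 (dcoef j c) y + be * (i == j)%:R).
Proof.
apply/funext => x; rewrite /partial.
(* [P] is the restriction to the line through [x] in direction [j], which turns [derive1] into a
   formal derivative. *)
pose P : {poly R} := \sum_(l : midx d)
   (c l * \prod_(k | k != j) Zb (l k) (d k) (x k 0)) *:
     (Zpoly (l j) (d j) \Po ('X + (x j 0)%:P))
   + (al%:P + be *: ((x i 0)%:P + (i == j)%:R *: 'X)).
have -> : (fun t => bern1 c (x + t *: delta_mx j 0) +
    (al + be * (x + t *: delta_mx j 0) i 0)) = horner P.
  apply/funext => t; rewrite /P hornerD horner_sum; congr (_ + _); last first.
    by rewrite !hornerE !mxE eqxx andbT [t * _]mulrC.
  apply: eq_bigr => l _; rewrite hornerZ horner_comp horner_Zpoly hornerD hornerX hornerC.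
  rewrite /bbasis (bigD1 j) //= -[RHS]mulrA; congr (c l * _).
  rewrite [LHS]mulrC; congr (_ * _).
    by apply: eq_bigr => k kj; rewrite !mxE (negPf kj) mulr0 addr0.
  by rewrite !mxE !eqxx mulr1 [t + _]addrC.
rewrite -derivE /P derivD hornerD; congr (_ + _); last first.
  by rewrite derivD derivZ derivD !derivC derivZ derivX !add0r !hornerZ hornerC mulr1.
rewrite raddf_sum horner_sum /=.
pose phi k i := if k == j then (Zpoly i (d k))^`().[x k 0] else Zb i (d k) (x k 0).
transitivity (\sum_(l : midx d) c l * \prod_k phi k (l k)).
  apply: eq_bigr => l _; rewrite derivZ hornerZ deriv_comp hornerM horner_comp.
  rewrite derivD derivX derivC addr0 hornerD hornerX !hornerC add0r mulr1.
  rewrite [in RHS](bigD1 j) //= {1}/phi eqxx.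
  rewrite -[LHS]mulrA; congr (c l * _); rewrite [LHS]mulrC; congr (_ * _).
  by apply: eq_bigr => k /negPf kj; rewrite /phi kj.
apply: bern1_tcoef => k a ad; rewrite /phi /dcoef_mx /decdeg.
case: eqP => _; first exact: deriv_Zpoly.
have ad' : (a < (d k).+1)%N by [].
rewrite (bigD1 (Ordinal ad')) //= eqxx mul1r big1 ?addr0 // => l.
by rewrite -val_eqE /= eq_sym => /negPf ->; rewrite mul0r.
Qed.

End Tensor.

(** * Entrywise bounds from the infinity norms *)

Section Norms.
Context {R : realType}.

Lemma norm_le_vnorm p (v : 'cV[R]_p) j : `|v j 0| <= vnorm v.
Proof. exact: (le_bigmax 0 (fun j => `|v j 0|)). Qed.

Lemma vnorm_le p (v : 'cV[R]_p) (B : R) :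
  0 <= B -> (forall j, `|v j 0| <= B) -> vnorm v <= B.
Proof. by move=> B0 vB; apply: bigmax_le. Qed.

Lemma row_sum_le_mnorm p q (A : 'M[R]_(p, q)) i : \sum_j `|A i j| <= mnorm A.
Proof. exact: (le_bigmax 0 (fun i => \sum_j `|A i j|)). Qed.

Lemma norm_le_ctrl_norm N q (d : 'I_N -> nat) (b : midx d -> 'cV[R]_q) l a :
  `|b l a 0| <= ctrl_norm b.
Proof.
apply: le_trans (norm_le_vnorm _ (b l) a) _.
exact: (le_bigmax 0 (fun l => vnorm (b l))).
Qed.

Lemma ctrl_norm_ge0 N q (d : 'I_N -> nat) (b : midx d -> 'cV[R]_q) :
  0 <= ctrl_norm b.
Proof. exact: bigmax_ge_id. Qed.

End Norms.

(** * Pseudoinverse and inverse of the bordered Jacobian *)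

Section BorderedInverse.
Context {R : realType} {n : nat}.
Implicit Type J : 'M[R]_(n, n.+1).

(** The Gram matrix is invertible: [v J J^T = 0] makes the sum of squares of [v J] vanish, and the
    rows of [J] are independent. *)
Lemma mulmx_pinv J : (n <= \rank J)%N -> J *m Defs.pinv J = 1%:M.
Proof.
move=> Jn; rewrite /Defs.pinv mulmxA mulmxV //.
have Jfree : row_free J by rewrite /row_free eqn_leq rank_leq_row.
rewrite -row_free_unit; apply: inj_row_free => v vJJ.
have : (v *m J) *m (v *m J)^T = 0.
  by rewrite trmx_mul !mulmxA -[v *m J *m _]mulmxA vJJ mul0mx.
move=> /matrixP/(_ 0 0); rewrite !mxE => /eqP.
under eq_bigr => j _ do rewrite [X in _ * X]mxE -expr2.
rewrite psumr_eq0 => [/allP H|j _]; last exact: sqr_ge0.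
apply: (row_free_inj Jfree); rewrite mul0mx; apply/rowP => j.
have := H j (mem_index_enum _); rewrite /= sqrf_eq0 => /eqP ->.
by rewrite mxE.
Qed.

(** The Jacobian of [hfun b i k], for every [k], when [J] is that of [bern b]. *)
Definition border J (i : 'I_n.+1) : 'M[R]_n.+1 :=
  \matrix_(a, c) if unlift ord_max a is Some a' then J a' c else (i == c)%:R.

(* Adding a multiple of a kernel vector v of J corrects the i-th coordinate of a
   preimage; choosing i where |v i| is largest makes this at most double norms. *)
Lemma border_inverse J : (n <= \rank J)%N ->
  exists i (B : 'M[R]_n.+1), [/\ border J i *m B = 1%:M,
    forall p, \sum_(q < n) `|B p (lift ord_max q)| <= 2 * mnorm (Defs.pinv J) &
    forall p, `|B p ord_max| <= 1].
Proof.
move=> Jn; have JP := mulmx_pinv J Jn; set P := Defs.pinv J in JP *.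
have [v v0 Jv] : exists2 v : 'cV[R]_n.+1, v != 0 & J *m v = 0.
  have /rowV0Pn[u] : kermx J^T != 0.
    rewrite -mxrank_eq0 mxrank_ker -lt0n subn_gt0.
    by rewrite mxrank_tr (leq_ltn_trans (rank_leq_row J)).
  move=> /sub_kermxP uJ u0; exists u^T; first by rewrite -(inj_eq trmx_inj) trmx0 trmxK.
  by rewrite -[J]trmxK -trmx_mul uJ trmx0.
pose i := [arg max_(i > ord0 : 'I_n.+1) `|v i 0|]%O.
have vi p : `|v p 0| <= `|v i 0| by rewrite /i; case: arg_maxP => // j _; apply.
have vi0 : v i 0 != 0.
  apply: contraNneq v0 => vi0; apply/eqP/colP => p; rewrite mxE.
  by apply/eqP; have := vi p; rewrite vi0 normr0 normr_le0.
have ratio p : `|v p 0 / v i 0| <= 1.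
  by rewrite normrM normfV ler_pdivrMr ?normr_gt0 // mul1r.
(* The first [n] columns are those of [P], shifted along [v] to have [i]-th coordinate 0; the last
   is [v] scaled to have [i]-th coordinate 1. *)
exists i, (\matrix_(p, q) if unlift ord_max q is Some q'
    then P p q' - v p 0 / v i 0 * P i q' else v p 0 / v i 0); split.
- apply/matrixP => a q; rewrite !mxE.
  have JvE a' : \sum_p J a' p * (v p 0 / v i 0) = 0.
    move/matrixP/(_ a' 0): Jv; rewrite !mxE => Jv.
    by under eq_bigr do rewrite mulrA; rewrite -mulr_suml Jv mul0r.
  under eq_bigr => p _ do rewrite !mxE.
  case: (unliftP ord_max a) => [a' ->|->]; case: (unliftP ord_max q) => [q' ->|->].
  + rewrite (inj_eq (@lift_inj _ ord_max)).
    under eq_bigr do rewrite mulrBr mulrA.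
    rewrite sumrB -mulr_suml JvE mul0r subr0.
    by move/matrixP/(_ a' q'): JP; rewrite !mxE => ->.
  + by rewrite JvE eq_sym (negPf (neq_lift _ _)).
  + rewrite (bigD1 i) //= eqxx mul1r big1 => [|p]; last first.
      by rewrite eq_sym => /negPf ->; rewrite mul0r.
    by rewrite divff // mul1r subrr addr0 (negPf (neq_lift _ _)).
  + rewrite (bigD1 i) //= eqxx mul1r big1 => [|p]; last first.
      by rewrite eq_sym => /negPf ->; rewrite mul0r.
    by rewrite divff // addr0 eqxx.
- move=> p; under eq_bigr => q _ do rewrite mxE liftK.
  apply: (@le_trans _ _ (\sum_(q < n) (`|P p q| + `|P i q|))).
    apply: ler_sum => q _; apply: le_trans (ler_normB _ _) _.
    by rewrite lerD2l normrM ler_piMl.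
  rewrite big_split /= mulr2n mulrDl mul1r.
  by apply: lerD; apply: row_sum_le_mnorm.
- by move=> p; rewrite mxE unlift_none.
Qed.

End BorderedInverse.

(** * Estimates for the exclusion test, [eta] and [omega_hat] *)

Section Surface.
Context {R : realType} {n : nat} (m : 'I_n.+1 -> nat) (b : midx m -> 'cV[R]_n).
Local Notation N := n.+1.
Local Notation M := (ctrl_norm b).
Local Notation f := (bern b).

Lemma deg_le_mbar k : ((m k)%:R <= (mbar m)%:R :> R).
Proof. by rewrite ler_nat /mbar; apply: (leq_bigmax k). Qed.

Lemma jac_bern x : jac f x =
  \matrix_(a, k) bern1 (dcoef k (fun l => b l a 0)) x.
Proof.
apply/matrixP => a k; rewrite !mxE.
have -> : (fun y => f y a 0) =
    (fun y => bern1 (fun l => b l a 0) y + (0 + 0 * y k 0)).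
  by apply/funext => y; rewrite bern_coord mul0r !addr0.
by rewrite partial_bern1 mul0r addr0.
Qed.

Lemma jac_bern_le x a k : @cube R N x ->
  `|jac f x a k| <= M * (2 * (mbar m)%:R).
Proof.
move=> cx; rewrite jac_bern mxE; apply: bern1_le => // l.
apply: le_trans (_ : M * (2 * (m k)%:R) <= _); last first.
  by rewrite ler_wpM2l ?ctrl_norm_ge0 // ler_wpM2l // deg_le_mbar.
by apply: dcoef_le => i; exact: norm_le_ctrl_norm.
Qed.

Lemma jac_hfun i k x : jac (hfun b i k) x = border (jac f x) i.
Proof.
apply/matrixP => a c; rewrite !mxE; case: unliftP => [a' ->|->].
  rewrite mxE; congr (partial _ _ _); apply/funext => y.
  by rewrite mxE liftK.
have -> : (fun y => hfun b i k y ord_max 0) =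
   (fun y => bern1 (fun _ : midx m => 0) y + (- k + 1 * y i 0)).
  apply/funext => y; rewrite mxE unlift_none /bern1 big1 ?mul1r ?add0r 1?addrC //.
  by move=> l _; rewrite mul0r.
rewrite partial_bern1 mul1r /bern1 big1 ?add0r // => l _.
by rewrite /dcoef /tcoef big1 ?mul0r // => l' _; rewrite mul0r.
Qed.

Lemma bern_le x : @cube R N x -> vnorm (f x) <= M.
Proof.
move=> cx; apply: vnorm_le; first exact: ctrl_norm_ge0.
move=> a; rewrite bern_coord; apply: bern1_le => // l.
exact: norm_le_ctrl_norm.
Qed.

(** If a convex combination of the control points vanished, [f x0] would equal minus the same
    combination of their deviations from [f x0], each too small for that. *)
Lemma exclusion_far x0 r : 0 < r -> @cube R N x0 -> cball x0 r `<=` @cube R N ->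
  2 * (N%:R * (mbar m)%:R) * r * M < vnorm (f x0) -> exclusion_test b x0 r.
Proof.
move=> r0 cx0 ballX far [lam [lam0 [lam1 hull]]].
pose u k := x0 k 0 - r; pose v k := x0 k 0 + r.
(* A shift of all coordinates by the same [s] stays in the ball; [s = - r] and [s = r] give the two
   corners. *)
have in01 (s : R) : `|s| <= r -> forall k, 0 <= x0 k 0 + s <= 1.
  move=> sr k; have /ballX/(_ k) : cball x0 r (x0 + s *: const_mx 1).
    rewrite /cball /= addrC addKr; apply: vnorm_le; first exact: ltW.
    by move=> j; rewrite !mxE mulr1.
  by rewrite !mxE mulr1.
have u01 k : 0 <= u k <= 1 by apply: in01; rewrite normrN gtr0_norm.
have v01 k : 0 <= v k <= 1 by apply: in01; rewrite gtr0_norm.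
have coefsE : bern_coefs m (fhat b x0 r) =1
    (fun l => \col_a box_coef u v (fun i => b i a 0) l).
  apply: bern_coefsP => y _; apply/colP => a; rewrite /fhat !bern_coord.
  under [RHS]eq_bigr => l _ do rewrite mxE.
  rewrite -[RHS]bern1_box; congr (bern1 _ _); apply/colP => k.
  rewrite !mxE /u /v; ring.
move: far; apply/negP; rewrite -leNgt.
set Bd := leRHS; have Bd0 : 0 <= Bd by rewrite !mulr_ge0 ?ctrl_norm_ge0 // ltW.
apply: vnorm_le => // a.
have -> : f x0 a 0 =
    - \sum_l lam l * (box_coef u v (fun i => b i a 0) l - bern1 (fun i => b i a 0) x0).
  under eq_bigr => l _ do rewrite mulrBr.
  rewrite sumrB -mulr_suml lam1 mul1r -bern_coord.
  move/colP/(_ a): hull; rewrite summxE mxE.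
  under eq_bigr => l _ do rewrite mxE coefsE mxE.
  by move=> ->; rewrite sub0r opprK.
rewrite normrN; apply: le_trans (ler_norm_sum _ _ _) _.
have -> : Bd = \sum_l lam l * Bd by rewrite -mulr_suml lam1 mul1r.
apply: ler_sum => l _.
rewrite normrM (ger0_norm (lam0 l)) ler_wpM2l //.
apply: le_trans (_ : M * (\sum_k 2 * (m k)%:R * r) <= _).
  apply: box_coef_near => // [k|k|i]; last exact: norm_le_ctrl_norm.
    by rewrite /u addrAC subrr add0r normrN gtr0_norm.
  by rewrite /v addrAC subrr add0r gtr0_norm.
rewrite /Bd [leRHS]mulrC ler_wpM2l ?ctrl_norm_ge0 //.
apply: (@le_trans _ _ (\sum_(k < N) 2 * (mbar m)%:R * r)).
  apply: ler_sum => k _; rewrite ler_wpM2r ?(ltW r0) // ler_wpM2l //; exact: deg_le_mbar.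
rewrite sumr_const card_ord -mulr_natl le_eqVlt.
by apply/orP; left; apply/eqP; ring.
Qed.

(** In the product of [B] with [hfun b i k x0], the first [n] columns meet [f x0] and the last one
    meets [x0 i 0 - k]. *)
Lemma eta_le i k x0 (B : 'M[R]_N) (s r : R) :
  border (jac f x0) i *m B = 1%:M ->
  (forall p, \sum_(q < n) `|B p (lift ord_max q)| <= s) ->
  (forall p, `|B p ord_max| <= 1) -> `|x0 i 0 - k| <= r ->
  Defs.eta b i k x0 <= s * vnorm (f x0) + r.
Proof.
move=> HB Bs B1 kr; rewrite /Defs.eta jac_hfun.
have [Hu _] := mulmx1_unit HB.
have -> : invmx (border (jac f x0) i) = B by rewrite -[RHS](mulKmx Hu) HB mulmx1.
have f0 : 0 <= vnorm (f x0) by exact: bigmax_ge_id.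
have s0 : 0 <= s by apply: le_trans (Bs ord0); apply: sumr_ge0 => q _.
have r0 : 0 <= r by apply: le_trans kr.
apply: vnorm_le; first by rewrite addr_ge0 ?mulr_ge0.
move=> p; rewrite mxE (bigD1_ord ord_max) //= mxE unlift_none addrC.
apply: le_trans (ler_normD _ _) _; apply: lerD; last first.
  by rewrite normrM -[leRHS]mul1r ler_pM.
apply: le_trans (ler_norm_sum _ _ _) _.
apply: le_trans (_ : (\sum_(q < n) `|B p (lift ord_max q)|) * vnorm (f x0) <= _).
  rewrite mulr_suml; apply: ler_sum => q _.
  by rewrite normrM mxE liftK ler_wpM2l // norm_le_vnorm.
by rewrite ler_wpM2r.
Qed.

(** Extension to the larger box costs at most [theta], the inverse matrix [s], and each of two
    differentiations [2 * mbar m]; the affine last component disappears. *)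
Lemma omega_hat_le i k x0 (B : 'M[R]_N) (s : R) :
  border (jac f x0) i *m B = 1%:M ->
  (forall p, \sum_(q < n) `|B p (lift ord_max q)| <= s) ->
  omega_hat b i k x0 <= 2 * (N%:R * (mbar m)%:R) ^+ 2 * theta R m * (s * M).
Proof.
move=> HB Bs.
have s0 : 0 <= s by apply: le_trans (Bs ord0); apply: sumr_ge0 => q _.
have M0 := ctrl_norm_ge0 _ _ _ b.
have th0 : 0 <= theta R m.
  apply: le_trans (theta_ge m).
  by apply: prodr_ge0 => j _; rewrite exprn_ge0.
have [Hu _] := mulmx1_unit HB.
have HinvB : invmx (border (jac f x0) i) = B by rewrite -[RHS](mulKmx Hu) HB mulmx1.
pose C := s * (M * theta R m) * (2 * (mbar m)%:R) * (2 * (mbar m)%:R).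
have C0 : 0 <= C by rewrite !mulr_ge0.
suff coefs_le i' j k' l : `|bern_coefs1 (decdeg (decdeg m j) k')
    (partial (partial (fun y => Ghat b i k x0 y i' 0) j) k') l| <= C.
  rewrite /omega_hat; apply: (@le_trans _ _ (N%:R ^+ 2 / 2 * C)).
    rewrite ler_wpM2l ?divr_ge0 ?exprn_ge0 //.
    by apply: bigmax_le => // i' _; apply: bigmax_le => // j _;
       apply: bigmax_le => // k' _; apply: bigmax_le => // l _.
  by rewrite /C le_eqVlt; apply/orP; left; apply/eqP; field.
pose cB (q : 'I_n) : midx m -> R :=
  box_coef (fun=> - (1 / 2)) (fun=> 3 / 2) (fun l => b l q 0).
pose cG (l : midx m) := \sum_(q < n) B i' (lift ord_max q) * cB q l.
have -> : (fun y => Ghat b i k x0 y i' 0) = (fun y => bern1 cG y +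
    (B i' ord_max * (- (1 / 2) - k) + B i' ord_max * 2 * y i 0)).
  apply/funext => y; rewrite /Ghat jac_hfun HinvB mxE (bigD1_ord ord_max) //=.
  rewrite addrC; congr (_ + _); last by rewrite mxE unlift_none !mxE; field.
  rewrite /cG /bern1; under [RHS]eq_bigr => l' _ do rewrite mulr_suml.
  rewrite exchange_big; apply: eq_bigr => q _ /=.
  under [RHS]eq_bigr => l' _ do rewrite -mulrA.
  rewrite -mulr_sumr; congr (_ * _); rewrite mxE liftK bern_coord.
  rewrite -/(bern1 _ _) -bern1_box; congr (bern1 _ _); apply/colP => j'.
  by rewrite !mxE; field.
rewrite partial_bern1.
have -> : (fun y : 'cV[R]_N => bern1 (dcoef j cG) y + B i' ord_max * 2 * (i == j)%:R) =
  (fun y => bern1 (dcoef j cG) y + (B i' ord_max * 2 * (i == j)%:R + 0 * y i 0)).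
  by apply/funext => y; rewrite mul0r addr0.
rewrite partial_bern1.
rewrite (bern_coefs1P _ _ (dcoef k' (dcoef j cG))); last first.
  by move=> y _; rewrite mul0r addr0.
have cG_le l' : `|cG l'| <= s * (M * theta R m).
  apply: le_trans (ler_norm_sum _ _ _) _.
  apply: le_trans (_ : (\sum_(q < n) `|B i' (lift ord_max q)|) * (M * theta R m) <= _);
    last by rewrite ler_wpM2r // mulr_ge0.
  rewrite mulr_suml; apply: ler_sum => q _; rewrite normrM ler_wpM2l //.
  apply: le_trans (_ : M * \prod_k 2 ^+ m k <= _); last first.
    by rewrite ler_wpM2l // theta_ge.
  (* Both endpoints -1/2 and 3/2 satisfy [|1 - t| + |t| = 2]. *)
  apply: box_coef_le => [_|_|l'']; last exact: norm_le_ctrl_norm.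
    by rewrite ger0_norm ?ler0_norm; lra.
  by rewrite ler0_norm ?ger0_norm; lra.
have dcG_le l' : `|dcoef j cG l'| <= s * (M * theta R m) * (2 * (mbar m)%:R).
  apply: le_trans (dcoef_le _ _ _ _ _ cG_le) _.
  by rewrite ler_wpM2l ?mulr_ge0 // ler_wpM2l // deg_le_mbar.
apply: le_trans (dcoef_le _ _ _ _ _ dcG_le) _.
rewrite ler_wpM2l ?mulr_ge0 // ler_wpM2l //.
(* The second differentiation acts on degrees already lowered in direction [j], still at most
   [mbar m]. *)
apply: le_trans (deg_le_mbar k'); rewrite ler_nat /decdeg.
by case: eqP => // _; exact: leq_pred.
Qed.

End Surface.

(** With [t] the square root, [2 e w = 1 - t^2 = (1 - t) (1 + t)], which is at least [1 - t] as
    [0 <= t <= 1]. *)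
Lemma rho_minus_le (R : realType) (e w : R) :
  0 <= e -> 0 <= w -> e * w <= 1 / 4 -> rho_minus e w <= 2 * e.
Proof.
move=> e0 w0 ew; rewrite /rho_minus; case: eqVneq => [_|wn0]; first by lra.
have {}w0 : 0 < w by rewrite lt0r wn0.
have ew0 : 0 <= e * w by rewrite mulr_ge0 // ltW.
have z0 : 0 <= 1 - 2 * e * w by lra.
have := sqr_sqrtr z0; have := sqrtr_ge0 (1 - 2 * e * w).
rewrite ler_pdivrMr //; move: (Num.sqrt _) => t t0 tz; nra.
Qed.

Lemma rho_plus_gt (R : realType) (e w r : R) :
  0 < w -> r * w < 1 -> r < rho_plus e w.
Proof.
move=> w0 rw; rewrite /rho_plus ltr_pdivlMr //.
by apply: lt_le_trans rw _; rewrite lerDl sqrtr_ge0.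
Qed.

(** * Consequences of a finite condition number *)

Section Dichotomy.
Context {R : realType} {n : nat} (m : 'I_n.+1 -> nat) (b : midx m -> 'cV[R]_n).
Local Notation N := n.+1.
Local Notation M := (ctrl_norm b).
Local Notation f := (bern b).

Lemma omega_hat_ge0 i k x0 : 0 <= omega_hat b i k x0.
Proof. by rewrite /omega_hat mulr_ge0 ?divr_ge0 ?exprn_ge0 // bigmax_ge_id. Qed.

(** Here [s] is the supremum in [kappa]. It bounds the minimum at [x0], so one of the two terms is
    at most [s], hence not infinite. *)
Lemma kappa_dichotomy x0 :
  (kappa b < +oo)%E -> fine (kappa b) != 0 -> @cube R N x0 ->
  exists s : R, [/\ fine (kappa b) = s * M, 0 <= s, 0 < M &
    1 <= s * vnorm (f x0) \/
    (n <= \rank (jac f x0))%N /\ mnorm (Defs.pinv (jac f x0)) <= s].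
Proof.
move=> kfin k0 cx0.
have M0 : 0 < M.
  move: k0; rewrite /kappa lt0r ctrl_norm_ge0 andbT.
  by apply: contra_neq => ->; rewrite mul0e.
move: kfin {k0}; rewrite /kappa; set S := ereal_sup _ => kfin.
have Sx0 : (Order.min (inv_norm (f x0)) (pinv_norm (jac f x0)) <= S)%E.
  by apply: ereal_sup_ubound; exists x0.
have inv0 : (0 <= inv_norm (f x0))%E.
  by rewrite /inv_norm; case: ifP => // _; rewrite lee_fin divr_ge0 // bigmax_ge_id.
have pinv0 : (0 <= pinv_norm (jac f x0))%E.
  by rewrite /pinv_norm; case: ifP => // _; rewrite lee_fin bigmax_ge_id.
have S0 : (0 <= S)%E by apply: le_trans Sx0; rewrite le_min inv0 pinv0.
(* An infinite supremum is excluded since [M > 0] would make [kappa] infinite. *)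
move: kfin S0 Sx0; case: S => [s| |] //; last by rewrite gt0_muley ?lte_fin.
rewrite lee_fin => _ s0 Sx0; exists s; split => //; first by rewrite /= mulrC.
move: Sx0; rewrite ge_min => /orP[|].
  rewrite /inv_norm; case: eqVneq => // f0; rewrite lee_fin.
  have fgt0 : 0 < vnorm (f x0) by rewrite lt0r f0 bigmax_ge_id.
  by rewrite ler_pdivrMr //; left.
rewrite /pinv_norm; case: ltnP => // rk; rewrite lee_fin => Ps.
by right.
Qed.

(** In the first case [|f x0| <= M] suffices. In the second, a diagonal entry 1 of [J *m pinv J] is
    a sum of [N] products, each at most [2 * mbar m * M * s]. *)
Lemma kappa_lower s x0 : 0 <= s -> 0 < M -> @cube R N x0 -> (0 < mbar m)%N ->
  1 <= s * vnorm (f x0) \/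
    (n <= \rank (jac f x0))%N /\ mnorm (Defs.pinv (jac f x0)) <= s ->
  1 <= 2 * (N%:R * (mbar m)%:R) * (s * M).
Proof.
move=> s0 M0 cx0 mb0 [fs|[rk Ps]].
  have sM : 1 <= s * M.
    by apply: le_trans fs _; rewrite ler_wpM2l // bern_le.
  have : 1 <= N%:R * (mbar m)%:R :> R by rewrite -natrM ler1n muln_gt0.
  move: (N%:R * _) (s * M) sM => L K; nra.
(* A diagonal entry exists: for [n = 0] the control points are empty vectors and [M] would be 0. *)
have n0 : (0 < n)%N.
  rewrite lt0n; apply: contraTneq M0 => n0; rewrite -leNgt.
  apply: bigmax_le => // l _; apply: vnorm_le => // j.
  by have := ltn_ord j; rewrite [X in (_ < X)%N]n0.
pose a := Ordinal n0.
have := mulmx_pinv _ rk => /matrixP/(_ a a); rewrite !mxE eqxx => JP.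
rewrite -[leLHS]/(true%:R) -JP.
apply: le_trans (ler_norm _) _; apply: le_trans (ler_norm_sum _ _ _) _.
apply: (@le_trans _ _ (\sum_(j < N) M * (2 * (mbar m)%:R) * s)).
  apply: ler_sum => j _; rewrite normrM ler_pM //; first exact: jac_bern_le.
  apply: le_trans Ps; apply: le_trans (row_sum_le_mnorm _ _ _ j).
  by rewrite (bigD1 a) //= lerDl sumr_ge0.
rewrite sumr_const card_ord -mulr_natl le_eqVlt; apply/orP; left; apply/eqP; ring.
Qed.

End Dichotomy.

(** * Combining the estimates into the choice between the two tests *)

Theorem theorem4 (R : realType) (n : nat) (m : 'I_n.+1 -> nat)
  (b : midx m -> 'cV[R]_n) (x0 : 'cV[R]_n.+1) (r : R) :
  (kappa b < +oo)%E ->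
  @cube R n.+1 x0 -> 0 < r -> cball x0 r `<=` @cube R n.+1 ->
  r < (c0 R m / fine (kappa b)) ^+ 2 ->
  (exists i : 'I_n.+1,
      kantorovich_test_i b x0 r i /\ cball x0 r `<=` explored_region b x0 r i)
  \/ exclusion_test b x0 r.
Proof.
move=> kfin cx0 r0 ballX rk.
(* Division by 0 yields 0, so [0 < r] and the bound on [r] exclude the degenerate cases
   [kappa b = 0] and [mbar m = 0]. *)
have ratio_neq0 : c0 R m / fine (kappa b) != 0.
  apply: contraTneq rk => ->; rewrite expr0n /= -leNgt; exact: ltW.
have [c0n0 kn0] : c0 R m != 0 /\ fine (kappa b) != 0.
  by move: ratio_neq0; rewrite mulf_eq0 negb_or invr_eq0 => /andP.
have mb0 : (0 < mbar m)%N.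
  rewrite lt0n; apply: contraNneq c0n0 => mb0.
  by rewrite /c0 mb0 expr0n /= mulr0 invr0 mulr0.
have [s [kE s0 M0 dich]] := kappa_dichotomy m b x0 kfin kn0 cx0.
have kapL := kappa_lower m b s x0 s0 M0 cx0 mb0 dich.
have th1 : 1 <= theta R m.
  apply: le_trans (theta_ge m).
  by elim/big_ind: _ => // [x y|k _]; [exact: mulr_ege1 | rewrite exprn_ege1 // ler1n].
have L1 : 1 <= n.+1%:R * (mbar m)%:R :> R by rewrite -natrM ler1n muln_gt0.
set L := _ * (mbar m)%:R in L1 kapL; set th := theta R m in th1.
have K0 : 0 < s * ctrl_norm b.
  rewrite lt0r mulr_ge0 ?(ltW M0) // andbT; apply: contraTneq kapL => ->.
  by rewrite mulr0 -ltNge.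
set K := s * ctrl_norm b in K0 kE kapL.
have Lgt0 : 0 < L by apply: lt_le_trans L1.
have thgt0 : 0 < th by apply: lt_le_trans th1.
have [L0 th0] := (ltW Lgt0, ltW thgt0).
(* Here [4096 = 64^2]: dropping one factor [N] and the power of 3/2 from [1 / c0] leaves
   [64 L^2 th], and the bound on [r] is squared. *)
have gr : 4096 * (L ^+ 4 * th ^+ 2 * K ^+ 2 * r) <= 1.
  have Q64 : 64 * (L ^+ 2 * th) <= (c0 R m)^-1.
    rewrite /c0 div1r invrK -/th.
    have N1 : 1 <= n.+1%:R :> R by rewrite ler1n.
    have P1 : 1 <= (3 / 2) ^+ mbar m :> R by rewrite exprn_ege1 //; lra.
    have -> : 64 * n.+1%:R ^+ 3 * th * (3 / 2) ^+ mbar m * (mbar m)%:R ^+ 2 =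
        64 * (L ^+ 2 * th) * (n.+1%:R * (3 / 2) ^+ mbar m) by rewrite /L; ring.
    rewrite ler_peMr ?mulr_ege1 //.
    by rewrite !mulr_ge0 ?exprn_ge0.
  have c0gt0 : 0 < c0 R m.
    rewrite -invr_gt0; apply: lt_le_trans Q64.
    by rewrite mulr_gt0 // mulr_gt0 // exprn_gt0.
  have LK : 64 * (L ^+ 2 * th) * K <= K / c0 R m.
    by rewrite [leRHS]mulrC ler_wpM2r // (ltW K0).
  have : (64 * (L ^+ 2 * th) * K) ^+ 2 * r <= 1.
    apply: (@le_trans _ _ ((K / c0 R m) ^+ 2 * (c0 R m / K) ^+ 2)).
      apply: ler_pM; rewrite ?sqr_ge0 ?(ltW r0) //; last by rewrite -kE ltW.
      have A0 : 0 <= 64 * (L ^+ 2 * th) * K.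
        by rewrite mulr_ge0 ?(ltW K0) // mulr_ge0 // mulr_ge0 // exprn_ge0.
      by rewrite ler_sqr ?nnegrE ?(le_trans A0 LK).
    by rewrite -exprMn mulrA divfK // divff ?expr1n // gt_eqF.
  by apply: le_trans; rewrite le_eqVlt; apply/orP; left; apply/eqP; ring.
have rK0 : 0 <= K ^+ 2 * r by rewrite mulr_ge0 ?sqr_ge0 // ltW.
(* Since [L] and [th] are at least 1, lower powers are also controlled by [gr]; [1 <= 2 L K]
   supplies missing factors [K]. *)
have g3 : L ^+ 3 * th * (K ^+ 2 * r) <= L ^+ 4 * th ^+ 2 * (K ^+ 2 * r).
  rewrite ler_wpM2r //; apply: ler_pM; rewrite ?exprn_ge0 //.
    by rewrite ler_weXn2l.
  by rewrite expr2 ler_peMr.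
have g2 : L ^+ 2 * (K ^+ 2 * r) <= L ^+ 4 * th ^+ 2 * (K ^+ 2 * r).
  rewrite ler_wpM2r // -[leLHS]mulr1; apply: ler_pM; rewrite ?exprn_ge0 //.
    by rewrite ler_weXn2l.
  by rewrite exprn_ege1.
have LKr : L * K * r <= 2 * (L ^+ 2 * (K ^+ 2 * r)).
  have -> : 2 * (L ^+ 2 * (K ^+ 2 * r)) = L * K * r * (2 * L * K) by ring.
  by rewrite ler_peMr // !mulr_ge0 // ltW.
have [far|near] := ltrP (2 * L * r * ctrl_norm b) (vnorm (bern b x0)).
  by right; apply: exclusion_far.
left; case: dich => [fs|[rank_n Ps]].
  (* Near zero, [s * |f x0| <= 2 L K r <= 4 / 4096], contradicting [1 <= s * |f x0|]. *)
  have : s * vnorm (bern b x0) <= s * (2 * L * r * ctrl_norm b) by rewrite ler_wpM2l.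
  have -> : s * (2 * L * r * ctrl_norm b) = 2 * (L * K * r) by rewrite /K; ring.
  lra.
(* Both [i] and [B] depend only on the Jacobian at [x0], so they serve for all [k] at once. *)
have [i [B [HB Bs B1]]] := border_inverse _ rank_n.
have {}Bs p : \sum_(q < n) `|B p (lift ord_max q)| <= 2 * s.
  by apply: le_trans (Bs p) _; rewrite ler_wpM2l.
have om_le k : omega_hat b i k x0 <= 4 * (L ^+ 2 * th * K).
  apply: le_trans (omega_hat_le m b i k x0 B (2 * s) HB Bs) _.
  by rewrite le_eqVlt; apply/orP; left; apply/eqP; rewrite /K /L /th; ring.
have om0 k : 0 <= omega_hat b i k x0 by exact: omega_hat_ge0.
have eta0 k : 0 <= Defs.eta b i k x0 by exact: bigmax_ge_id.
(* The constant 6 is 4 from [2 s * 2 L r M] plus 2 from [r <= 2 L K r]. *)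
have eta_bound k : x0 i 0 - r <= k <= x0 i 0 + r ->
    Defs.eta b i k x0 <= 6 * (L * K * r).
  move=> kr.
  apply: le_trans (_ : 2 * s * vnorm (bern b x0) + r <= _).
    apply: (eta_le m b i k x0 B (2 * s) r HB Bs B1); rewrite ler_norml; lra.
  have : 2 * s * vnorm (bern b x0) <= 4 * (L * K * r).
    apply: le_trans (_ : 2 * s * (2 * L * r * ctrl_norm b) <= _).
      by rewrite ler_wpM2l // mulr_ge0.
    by rewrite le_eqVlt; apply/orP; left; apply/eqP; rewrite /K; ring.
  have : r <= 2 * (L * K * r).
    have -> : 2 * (L * K * r) = r * (2 * L * K) by ring.
    by rewrite ler_peMr // ltW.
  lra.
have eta_om k : x0 i 0 - r <= k <= x0 i 0 + r ->
    Defs.eta b i k x0 * omega_hat b i k x0 <= 1 / 4.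
  move=> kr; apply: le_trans (_ : 6 * (L * K * r) * (4 * (L ^+ 2 * th * K)) <= _).
    by apply: ler_pM => //; exact: eta_bound.
  have -> : 6 * (L * K * r) * (4 * (L ^+ 2 * th * K)) =
    24 * (L ^+ 3 * th * (K ^+ 2 * r)) by ring.
  lra.
have r_om k : r * omega_hat b i k x0 < 1.
  apply: le_lt_trans (_ : r * (4 * (L ^+ 2 * th * K)) < 1).
    by rewrite ler_wpM2l // ltW.
  apply: le_lt_trans (_ : 8 * (L ^+ 3 * th * (K ^+ 2 * r)) < 1); last lra.
  have -> : 8 * (L ^+ 3 * th * (K ^+ 2 * r)) =
      r * (4 * (L ^+ 2 * th * K)) * (2 * L * K) by ring.
  by rewrite ler_peMr // !mulr_ge0 ?sqr_ge0 // ltW.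
exists i; split.
  move=> k kr; split; [|exact: eta_om|].
    by rewrite jac_hfun; have [] := mulmx1_unit HB.
  (* The radius is at most [2 eta <= 12 L K r <= 24 / 4096], well below the margin 1/2 around the
     cube. *)
  move=> x xball j; have := rho_minus_le _ _ _ (eta0 k) (om0 k) (eta_om k kr).
  have := eta_bound k kr; have := le_trans (norm_le_vnorm _ _ j) xball.
  have := cx0 j; rewrite !mxE ler_norml; lra.
move=> x xball; split; last split.
- have := le_trans (norm_le_vnorm _ _ i) xball; rewrite !mxE ler_norml; lra.
- by move=> j; have := ballX x xball j; lra.
(* The larger ball alone covers [X], because [r < 1 / omega_hat <= rho_plus] unless [omega_hat] is
   0, when membership holds by convention. *)
- move=> k kr; right; rewrite /in_oball_plus.
  have [->|om_n0] := eqVneq (omega_hat b i k x0) 0; [by left|right].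
  apply: le_lt_trans xball _; apply: rho_plus_gt => //.
  by rewrite lt0r om_n0 om0.
Qed.
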